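(* Let $E$ be a finite set with $N$ points and let $\succcurlyeq_1,\dots,\succcurlyeq_M$ be linear orders on $E$. For each $i$ and $x\in E$ let $j_i(x)\in\{1,\dots,N\}$ be the position of $x$ in the $i$-th order (writing $E$ as $x_{i1}\succ_i\dots\succ_i x_{iN}$, $x=x_{ij_i(x)}$), and define $F:E\to\mathbb{R}^M$ by $F(x)=(F_1(x),\dots,F_M(x))$ with $F_i(x)=-(M+1)^{j_i(x)}$. For $P\subseteq F(E)$ define $\mathrm{Pos}(P)=\{x\in\mathbb{R}^M:\ \forall i\ \exists p\in P \text{ with } x_i\geq p_i\}$ and $\mathrm{ExtHull}(P)=\{x\in\mathbb{R}^M:\ \exists p\in\mathrm{Hull}(P) \text{ with } x_i\geq p_i \ \forall i\}$, where $\mathrm{Hull}$ denotes the convex hull and subscripts denote coordinates. Then for every $P\subseteq F(E)$, $\mathrm{Pos}(P)\cap F(E)=\mathrm{ExtHull}(P)\cap F(E)$.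
   Context: A linear order is total and antisymmetric; $x\succ_i y$ means $x\succcurlyeq_i y$ and $x\ne y$. *)

(* Defs.v *)
From mathcomp Require Import all_boot all_order all_algebra.
From mathcomp Require Import all_classical all_reals convex.

Set Implicit Arguments.
Unset Strict Implicit.
Unset Printing Implicit Defensive.

Import Order.TTheory GRing.Theory Num.Theory.

Local Open Scope classical_set_scope.
Local Open Scope ring_scope.

(* Throughout, [ge x y] reads "x is above or equal to y" in the given order,
   so that the greatest element of a linear order has position 1. *)

Definition linear_order (E : Type) (ge : rel E) : Prop :=
  [/\ reflexive ge, antisymmetric ge, transitive ge & total ge].

Definition decreasing_enum (E : finType) (ge : rel E) : seq E :=
  sort ge (enum E).

Definition position (E : finType) (ge : rel E) (x : E) : nat :=
  (index x (decreasing_enum ge)).+1.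

Lemma position_bounds (E : finType) (ge : rel E) (x : E) :
  (1 <= position ge x <= #|E|)%N.
Proof.
by rewrite /position cardE -(size_sort ge) index_mem mem_sort mem_enum.
Qed.

Lemma position_lt (E : finType) (ge : rel E) (x y : E) :
  linear_order ge -> (position ge x < position ge y)%N = ge x y && (x != y).
Proof.
case=> ge_refl ge_anti ge_trans ge_total.
have mem z : z \in decreasing_enum ge by rewrite mem_sort mem_enum.
have srt : sorted ge (decreasing_enum ge) by apply: sort_sorted.
have idx_ge u v : (index u (decreasing_enum ge) <
                   index v (decreasing_enum ge))%N -> ge u v.
  exact: (sorted_ltn_index ge_trans srt u v (mem u) (mem v)).
rewrite /position ltnS; apply/idP/andP => [lt_xy|[ge_xy neq_xy]].
  split; first exact: idx_ge.
  by apply/eqP => eq_xy; rewrite eq_xy ltnn in lt_xy.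
case: ltngtP => // [/idx_ge ge_yx|eq_idx].
  by move: neq_xy; rewrite (ge_anti x y) ?eqxx // ge_xy ge_yx.
by move: neq_xy; rewrite (index_inj x (mem x) (mem y) eq_idx) eqxx.
Qed.

Definition F (R : realType) (M : nat) (E : finType) (ge : 'I_M -> rel E)
    (x : E) : 'rV[R]_M :=
  \row_(i < M) - (M.+1%:R ^+ position (ge i) x).

Definition Pos (R : realType) (M : nat) (P : set 'rV[R]_M) : set 'rV[R]_M :=
  [set x | forall i : 'I_M, exists2 p, P p & p ord0 i <= x ord0 i].

Definition Hull (R : realType) (M : nat) (P : set 'rV[R]_M) : set 'rV[R]_M :=
  smallest (@convex_set R 'rV[R]_M) P.

Definition ExtHull (R : realType) (M : nat) (P : set 'rV[R]_M) :
    set 'rV[R]_M :=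
  [set x | exists2 p, Hull P p & forall i : 'I_M, p ord0 i <= x ord0 i].

(* Main.v *)
Require Import Defs.
From mathcomp Require Import all_boot all_order all_algebra.
From mathcomp Require Import all_classical all_reals.
From mathcomp Require Import interval_inference convex lra.

(** ExtHull(P) is contained in Pos(P) because an open half-space
    [{q | c < q_i}] containing [P] contains its hull.  Conversely, let [x] in
    F(E) dominate, for each [i], some [p^i] in [P] in the i-th coordinate.
    Positions are injective, so either some [p^i] equals [x], or for each [i]
    the point of [p^i] sits at least one position further in the i-th order,
    whence [p^i_i <= (M + 1) x_i].  The k-th coordinate of the mean of the [p^i]
    is then at most [(M + 1) x_k / M <= x_k], the other terms being negative. *)

Set Implicit Arguments.
Unset Strict Implicit.
Unset Printing Implicit Defensive.

Import Order.TTheory GRing.Theory Num.Theory.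
Local Open Scope classical_set_scope.
Local Open Scope ring_scope.

Lemma lmod_convE (R : numDomainType) (V : lmodType R) (t : {i01 R}) (a b : V) :
  @conv R (convex_lmodType V) t a b = t%:num *: a + (1 - t%:num) *: b.
Proof. by []. Qed.

(** By induction: the mean of [n.+2] points gives weight [n.+2%:R^-1] to the last one and the
    remaining weight to the mean of the others. *)
Lemma convex_set_mean (R : numFieldType) (V : lmodType R) (A : set V) (n : nat)
    (v : 'I_n.+1 -> V) :
  @convex_set R V A -> (forall i, A (v i)) ->
  A (n.+1%:R^-1 *: \sum_(i < n.+1) v i).
Proof.
move=> cA; elim: n v => [|n IHn] v Av.
  by rewrite big_ord1 invr1 scale1r.
have t_ge0 : 0 <= n.+2%:R^-1 :> R by rewrite invr_ge0.
have t_le1 : n.+2%:R^-1 <= 1 :> R by rewrite invf_le1 ?ltr0n ?ler1n.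
have := cA _ _ (Itv01 t_ge0 t_le1) (mem_set (Av ord_max))
  (mem_set (IHn _ (fun i => Av (widen_ord (leqnSn _) i)))).
rewrite lmod_convE /= => /set_mem; congr (A _).
rewrite [in RHS]big_ord_recr /= scalerDr addrC; congr (_ + _).
rewrite scalerA; congr (_ *: _).
have n1_neq0 : n.+1%:R != 0 :> R by rewrite pnatr_eq0.
have n2_neq0 : n.+2%:R != 0 :> R by rewrite pnatr_eq0.
apply: (mulIf n1_neq0); rewrite mulfVK //; apply: (mulIf n2_neq0).
by rewrite mulrBl mul1r mulVf // mulrAC mulVf // mul1r -[n.+2%:R]natr1 addrK.
Qed.

Lemma Hull_sub_halfspace (R : realType) (M : nat) (P : set 'rV[R]_M)
    (i : 'I_M) (c : R) :
  (forall p, P p -> c < p ord0 i) -> forall p, Hull P p -> c < p ord0 i.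
Proof.
move=> P_gt.
apply: (@smallest_sub _ (@convex_set R 'rV[R]_M) P [set p | c < p ord0 i]) => //.
(* Only weights strictly between 0 and 1 need checking; both terms then keep the inequality
   strict. *)
apply/convex_setW => x y /set_mem /= cx /set_mem /= cy k k_gt0 k_lt1.
apply/mem_set; rewrite /= lmod_convE !mxE.
by nra.
Qed.

Lemma ExtHull_sub_Pos (R : realType) (M : nat) (P : set 'rV[R]_M) :
  ExtHull P `<=` Pos P.
Proof.
move=> x [q Hq q_le] i; apply: contrapT => noP.
have: x ord0 i < q ord0 i.
  apply: Hull_sub_halfspace Hq => p Pp.
  by rewrite ltNge; apply/negP => p_le; apply: noP; exists p.
by rewrite ltNge q_le.
Qed.

Lemma position_inj (E : finType) (ge : rel E) : injective (position ge).
Proof.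
have in_enum z : z \in decreasing_enum ge by rewrite mem_sort mem_enum.
by move=> x y [/(index_inj x (in_enum x) (in_enum y))].
Qed.

Lemma F_lt0 (R : realType) (M : nat) (E : finType)
    (ge : 'I_M -> rel E) (x : E) (i : 'I_M) :
  F R ge x ord0 i < 0.
Proof. by rewrite mxE oppr_lt0 exprn_gt0. Qed.

Lemma F_le (R : realType) (M : nat) (E : finType)
    (ge : 'I_M -> rel E) (x y : E) (i : 'I_M) :
  F R ge x ord0 i <= F R ge y ord0 i ->
  x = y \/ F R ge x ord0 i <= M.+1%:R * F R ge y ord0 i.
Proof.
(* The index [i] forces [M] to be positive, so the base exceeds 1 and powers compare as their
   exponents do. *)
have M1_gt1 : 1 < M.+1%:R :> R.
  by rewrite ltr1n ltnS (leq_ltn_trans _ (ltn_ord i)).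
rewrite !mxE lerN2 ler_eXn2l // leq_eqVlt => /orP[/eqP/position_inj ->|lt_pos].
  by left.
by right; rewrite mulrN lerN2 -exprS ler_eXn2l.
Qed.

Lemma Pos_F_sub_ExtHull (R : realType) (E : finType) (M : nat)
    (ge : 'I_M.+1 -> rel E) (P : set 'rV[R]_M.+1) :
  P `<=` range (F R ge) -> Pos P `&` range (F R ge) `<=` ExtHull P.
Proof.
move=> PF x [Pos_x [e _ ex]]; rewrite -{x}ex in Pos_x *.
have sub_Hull : P `<=` Hull P by apply: sub_smallest.
(* Outside this trivial case the alternative [x = y] of [F_le] is excluded in every coordinate. *)
have [Pe|nPe] := pselect (P (F R ge e)); first by exists (F R ge e); auto.
have /choice[p p_spec] : forall i, exists p, [/\ P p, forall k, p ord0 k < 0 &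
    p ord0 i <= M.+2%:R * F R ge e ord0 i].
  move=> i; have [p Pp p_le] := Pos_x i; have [d _ dp] := PF p Pp.
  move: Pp p_le; rewrite -dp => Pd /F_le[de|d_le].
    by case: nPe; rewrite -de.
  by exists (F R ge d); split => // k; exact: F_lt0.
exists (M.+1%:R^-1 *: \sum_i p i).
  apply: convex_set_mean => [x y t /set_mem Hx /set_mem Hy|i].
    (* The hull is convex: the combination stays in each convex [A] containing [P]. *)
    apply/mem_set => A [cA PA]; apply/set_mem/cA; apply/mem_set; [exact: Hx|exact: Hy].
  by apply: sub_Hull; case: (p_spec i).
(* After clearing the denominator, the k-th term alone is at most [M.+2%:R] times the negative
   [F R ge e ord0 k], hence below [M.+1%:R] times it. *)
move=> k; have [_ _ pk_le] := p_spec k.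
rewrite mxE summxE ler_pdivrMl // (bigD1 k) //=.
have : \sum_(i < M.+1 | i != k) p i ord0 k <= 0.
  by apply: sumr_le0 => i _; apply/ltW; case: (p_spec i).
have := F_lt0 R ge e k.
move: pk_le; rewrite -[M.+2%:R]natr1 mulrDl mul1r.
by lra.
Qed.

Theorem theorem3 (R : realType) (E : finType) (M : nat) (hM : (0 < M)%N)
    (ge : 'I_M -> rel E) (hge : forall i : 'I_M, linear_order (ge i))
    (P : set 'rV[R]_M) (hP : P `<=` range (@F R M E ge)) :
  Pos P `&` range (@F R M E ge) = ExtHull P `&` range (@F R M E ge).
Proof.
case: M hM ge hge P hP => // M _ ge _ P hP.
apply/seteqP; split=> x [x_in Fx]; split=> //; last exact: ExtHull_sub_Pos.
exact: (Pos_F_sub_ExtHull hP).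
Qed.
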